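(* For $f(x):=\|x\|_2^2$ on $\mathbb{R}^n$, and integers $1\le k\le n$, it holds that $$\min_{\substack{x\in\Delta_n\\ \mathrm{card}(x)\le k}}f(x)=\frac1k.$$
   Context: $\Delta_n:=\{x\in\mathbb{R}^n : x\ge0,\ \|x\|_1=1\}$ is the unit simplex, and $\mathrm{card}(x)$ denotes the number of non-zero coordinates of $x$. *)

(* Defs.v *)
From HB Require Import structures.
From mathcomp Require Import all_boot all_order all_algebra.
From mathcomp Require Import boolp classical_sets reals.

Set Implicit Arguments.
Unset Strict Implicit.
Unset Printing Implicit Defensive.

Import Order.TTheory GRing.Theory Num.Theory.
Local Open Scope classical_set_scope.
Local Open Scope ring_scope.

(* The library's norm on 'rV[R]_n is the sup norm, hence the definitions below. *)
Definition l1norm (R : realType) (n : nat) (x : 'rV[R]_n) : R :=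
  \sum_(i < n) `|x 0 i|.

Definition l2norm (R : realType) (n : nat) (x : 'rV[R]_n) : R :=
  Num.sqrt (\sum_(i < n) `|x 0 i| ^+ 2).

Definition unit_simplex (R : realType) (n : nat) : set 'rV[R]_n :=
  [set x : 'rV[R]_n | (forall i, 0 <= x 0 i) /\ l1norm x = 1].

Definition card_nz (R : realType) (n : nat) (x : 'rV[R]_n) : nat :=
  #|[pred i : 'I_n | x 0 i != 0]|.

(* [min A = m] as a relation, so that attainment of the minimum is asserted. *)
Definition is_min (R : realType) (A : set R) (m : R) : Prop :=
  A m /\ lbound A m.

(* Main.v *)
Require Import Defs.
From HB Require Import structures.
From mathcomp Require Import all_boot all_order all_algebra.
From mathcomp Require Import boolp classical_sets reals.
From mathcomp Require Import ring lra.

Import Order.TTheory GRing.Theory Num.Theory.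
Local Open Scope classical_set_scope.
Local Open Scope ring_scope.

(** The lower bound comes from the tangent line of [t ^+ 2] at [t = 1 / k],
    namely [2 t / k - 1 / k ^ 2 <= t ^+ 2].  Summed over the support of a point
    [x] of the simplex it gives [2 / k - card_nz x / k ^ 2 <= f x], and the left
    side is at least [1 / k] as soon as [card_nz x <= k]
    ([sum_sqr_ge_inv_card]).  Summing over the support only is what brings in
    the cardinality; outside it the tangent line would contribute a spurious
    negative term per coordinate.  The tangent touches at [1 / k], so equality
    holds at the point uniformly distributed on [k] coordinates; the
    first [k] ones serve ([uniform_row]). *)

Lemma sqr_l2norm (R : realType) (n : nat) (x : 'rV[R]_n) :
  l2norm x ^+ 2 = \sum_(i < n) x 0 i ^+ 2.
Proof.
rewrite sqr_sqrtr; last by apply: sumr_ge0 => i _; rewrite sqr_ge0.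
by apply: eq_bigr => i _; rewrite real_normK ?num_real.
Qed.

Lemma sum_unit_simplex (R : realType) (n : nat) (x : 'rV[R]_n) :
  @unit_simplex R n x -> \sum_(i < n) x 0 i = 1.
Proof.
by case=> x_ge0 <-; apply: eq_bigr => i _; rewrite ger0_norm.
Qed.

Lemma sqr_ge_tangent (R : realFieldType) (a t : R) :
  2 * a * t - a ^+ 2 <= t ^+ 2.
Proof. by have := sqr_ge0 (t - a); lra. Qed.

(** Each support coordinate costs the intercept [a ^+ 2] of the tangent line at
    [a = 1 / k], so a bound on the support size bounds the total loss by
    [k * a ^+ 2 = a], out of the [2 * a] that the linear parts add up to. *)
Lemma sum_sqr_ge_inv_card (R : realType) (n k : nat) (x : 'rV[R]_n) :
  (0 < k)%N -> \sum_(i < n) x 0 i = 1 -> (card_nz x <= k)%N ->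
  k%:R^-1 <= \sum_(i < n) x 0 i ^+ 2.
Proof.
move=> k_gt0 sum_x card_x.
have k_neq0 : k%:R != 0 :> R by rewrite pnatr_eq0 -lt0n.
pose a : R := k%:R^-1.
have supp_sum (g : R -> R) : g 0 = 0 ->
    \sum_(i < n) g (x 0 i) = \sum_(i < n | x 0 i != 0) g (x 0 i).
  move=> g0; rewrite [RHS]big_mkcond /=; apply: eq_bigr => i _.
  by case: eqP => // ->.
have card_a : (card_nz x)%:R * a ^+ 2 <= a.
  have {2}-> : a = k%:R * a ^+ 2 by rewrite /a; field.
  by rewrite ler_wpM2r ?sqr_ge0 // ler_nat.
have tangent_sum : 2 * a - (card_nz x)%:R * a ^+ 2 =
    \sum_(i < n | x 0 i != 0) (2 * a * x 0 i - a ^+ 2).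
  rewrite sumrB -mulr_sumr sumr_const -(supp_sum id) // sum_x mulr1.
  by rewrite -[in RHS](mulr_natl (a ^+ 2)).
apply: (@le_trans _ _ (2 * a - (card_nz x)%:R * a ^+ 2)).
  by rewrite -/a; lra.
rewrite tangent_sum (supp_sum (fun t => t ^+ 2)) ?expr0n //.
by apply: ler_sum => i _; apply: sqr_ge_tangent.
Qed.

Definition uniform_row (R : realType) (n k : nat) : 'rV[R]_n :=
  \row_(i < n) if (i < k)%N then k%:R^-1 else 0.

Lemma sum_uniform_row (R : realType) (n k : nat) (g : R -> R) :
  (k <= n)%N -> g 0 = 0 ->
  \sum_(i < n) g (uniform_row R n k 0 i) = k%:R * g k%:R^-1.
Proof.
move=> k_le_n g0.
have -> : k%:R * g k%:R^-1 = \sum_(i < k) g k%:R^-1.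
  by rewrite sumr_const card_ord mulr_natl.
rewrite (big_ord_widen n (fun _ => g k%:R^-1)) // [RHS]big_mkcond /=.
by apply: eq_bigr => i _; rewrite mxE; case: ifP.
Qed.

Lemma card_nz_uniform_row (R : realType) (n k : nat) :
  (k <= n)%N -> (card_nz (uniform_row R n k) <= k)%N.
Proof.
move=> k_le_n; rewrite -[leqRHS]card_ord -sum1_card.
rewrite (big_ord_widen n (fun _ => 1%N)) // sum1_card.
apply: subset_leq_card; apply/fintype.subsetP => i.
by rewrite !inE mxE; case: ifP => //; rewrite eqxx.
Qed.

Lemma unit_simplex_uniform_row (R : realType) (n k : nat) :
  (0 < k)%N -> (k <= n)%N -> unit_simplex (uniform_row R n k).
Proof.
move=> k_gt0 k_le_n; split=> [i|].
  by rewrite mxE; case: ifP => // _; rewrite invr_ge0 ler0n.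
rewrite /l1norm (sum_uniform_row _ _ _ (fun t => `|t|)) ?normr0 //.
by rewrite ger0_norm ?invr_ge0 ?ler0n // mulfV // pnatr_eq0 -lt0n.
Qed.

Theorem lemma10 (R : realType) (n k : nat) (k_gt0 : (1 <= k)%N)
    (k_le_n : (k <= n)%N) :
  let f := fun x : 'rV[R]_n => l2norm x ^+ 2 in
  is_min [set f x | x in [set x | @unit_simplex R n x /\ (card_nz x <= k)%N]]
    (1 / k%:R).
Proof.
move=> f; rewrite div1r; split.
  exists (uniform_row R n k).
    split; [exact: unit_simplex_uniform_row | exact: card_nz_uniform_row].
  have k_neq0 : k%:R != 0 :> R by rewrite pnatr_eq0 -lt0n.
  rewrite /f sqr_l2norm (sum_uniform_row _ _ _ (fun t => t ^+ 2)) ?expr0n //.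
  by field.
move=> _ [x [x_simplex card_x] <-]; rewrite /f sqr_l2norm.
by apply: sum_sqr_ge_inv_card => //; apply: sum_unit_simplex.
Qed.
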